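(* Let $\mathcal{H}$ be a Hilbert space. Let $H:\mathcal{H}\to\mathcal{H}$ be strongly monotone with constant $\gamma>0$ and Lipschitz continuous with constant $\tau>0$. Let $A:\mathcal{H}\to\mathcal{H}$ be Lipschitz continuous with constant $s>0$ and strongly monotone with respect to $H$ with constant $r>0$. Let $M:\mathcal{H}\to 2^{\mathcal{H}}$ be a strongly $H$-monotone operator with constant $\eta>0$. Let $\lambda>0$ be a constant such that $$\left|\lambda-\frac{r+\gamma\eta}{s^2-\eta^2}\right|<\frac{\sqrt{(r+\gamma\eta)^2-(s^2-\eta^2)(\tau^2-\gamma^2)}}{s^2-\eta^2},\qquad (r+\gamma\eta)^2>(s^2-\eta^2)(\tau^2-\gamma^2),\qquad s>\eta,$$ put $\kappa=\frac{1}{\gamma+\lambda\eta}\sqrt{\tau^2-2\lambda r+\lambda^2s^2}$, and let $x^*\in\mathcal{H}$ be the unique solution of the problem: find $u\in\mathcal{H}$ such that $0\in A(u)+M(u)$. Let $\{\xi_n\}_{n\ge0},\{\mu_n\}_{n\ge0}\subset[0,1]$ be real sequences with $\lim_{n\to\infty}\xi_n=0$, $\sum_{n=0}^{\infty}\xi_n=\infty$ and $\sum_{n=0}^{\infty}\xi_n\mu_n(1-\kappa)=\infty$. Let $u_0,q_0,\nu_0,s_0\in\mathcal{H}$ and define for all $n\in\mathbb{N}$ $$u_{n+1}=R^{H}_{M,\lambda}[Hu_n-\lambda Au_n],$$ $$r_n=(1-\mu_n)q_n+\mu_nR^{H}_{M,\lambda}[Hq_n-\lambda Aq_n],\qquad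 q_{n+1}=(1-\xi_n)q_n+\xi_nR^{H}_{M,\lambda}[Hr_n-\lambda Ar_n],$$ $$\nu_{n+1}=(1-\xi_n)\nu_n+\xi_nR^{H}_{M,\lambda}[H\nu_n-\lambda A\nu_n],$$ $$t_n=(1-\mu_n)s_n+\mu_n R^{H}_{M,\lambda}[Hs_n-\lambda As_n],\qquad s_{n+1}=R^{H}_{M,\lambda}[Ht_n-\lambda At_n].$$ Then the following are equivalent: (i) $\{u_n\}$ converges strongly to $x^*$; (ii) $\{q_n\}$ converges strongly to $x^*$; (iii) $\{\nu_n\}$ converges strongly to $x^*$; (iv) $\{s_n\}$ converges strongly to $x^*$.
   Context: $\mathbb{N}=\{0,1,2,\dots\}$; $2^{\mathcal{H}}$ is the family of all nonempty subsets of $\mathcal{H}$; $\langle\cdot,\cdot\rangle$ and $\|\cdot\|$ are the inner product and norm of $\mathcal{H}$. An operator $T:\mathcal{H}\to\mathcal{H}$ is strongly monotone with constant $c>0$ if $\langle Tx-Ty,x-y\rangle\ge c\|x-y\|^2$ for all $x,y\in\mathcal{H}$; it is strongly monotone with respect to $H:\mathcal{H}\to\mathcal{H}$ with constant $c>0$ if $\langle Tx-Ty,Hx-Hy\rangle\ge c\|x-y\|^2$ for all $x,y\in\mathcal{H}$; it is Lipschitz continuous with constant $c>0$ if $\|Tx-Ty\|\le c\|x-y\|$ for all $x,y\in\mathcal{H}$. A multivalued operator $M:\mathcal{H}\to 2^{\mathcal{H}}$ is strongly monotone with constant $\eta>0$ if $\langle x-y,u-v\rangle\ge\eta\|u-v\|^2$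 for all $u,v\in\mathcal{H}$, $x\in Mu$, $y\in Mv$. It is strongly $H$-monotone (with constant $\eta$) if it is strongly monotone (with constant $\eta$) and $(H+\lambda M)(\mathcal{H})=\mathcal{H}$ for all $\lambda>0$. The resolvent operator $R^{H}_{M,\lambda}:\mathcal{H}\to\mathcal{H}$ is $R^{H}_{M,\lambda}(u)=(H+\lambda M)^{-1}(u)$; it is a well-defined single-valued map when $H$ is continuous and strongly monotone and $M$ is strongly $H$-monotone. Under the stated hypotheses the problem $0\in A(u)+M(u)$ has a unique solution. The vectors $r_n\in\mathcal{H}$ and $s_n\in\mathcal{H}$ are not to be confused with the constants $r$ and $s$. *)

(* Defs.v *)
From HB Require Import structures.
From mathcomp Require Import all_boot all_order all_algebra.
From mathcomp Require Import sesquilinear.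
From mathcomp Require Import all_classical all_reals all_analysis.

Set Implicit Arguments.
Unset Strict Implicit.
Unset Printing Implicit Defensive.

Import Order.TTheory GRing.Theory Num.Theory.
Import numFieldNormedType.Exports.

Local Open Scope classical_set_scope.
Local Open Scope ring_scope.

(* A real Hilbert space is a complete normed module V together with a positive
   definite symmetric bilinear form dot : {dot V for idfun} inducing its norm,
   i.e. `|x| = Num.sqrt (dot x x). A multivalued operator V -> 2^V is a
   function V -> set V all of whose values are nonempty. *)

Section StrongMonotonicity.
Context {R : realType} {V : normedModType R}.
Implicit Types (dot : {dot V for @idfun R}) (c lambda : R).
Implicit Types (T H A : V -> V) (M F : V -> set V).

Definition strongly_monotone_wrt dot H c T :=
  forall x y, c * `|x - y| ^+ 2 <= dot (T x - T y) (H x - H y).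

Definition strongly_monotone dot c T :=
  forall x y, c * `|x - y| ^+ 2 <= dot (T x - T y) (x - y).

Definition set_strongly_monotone dot c M :=
  forall u v x y, M u x -> M v y -> c * `|u - v| ^+ 2 <= dot (x - y) (u - v).

Definition add_scale_set H lambda M : V -> set V :=
  fun u => [set H u + lambda *: x | x in M u].

Definition add_set A M : V -> set V := fun u => [set A u + x | x in M u].

Definition strongly_H_monotone dot H c M :=
  set_strongly_monotone dot c M /\
  forall lambda, 0 < lambda ->
    \bigcup_(u in [set: V]) add_scale_set H lambda M u = [set: V].

Definition set_inverse F : V -> set V := fun w => [set u | F u w].

(* (H + lambda M)^-1 as a function: [get] picks the element of the inverse
   image, which resolvent_unique shows to be a singleton in the case of
   interest. *)
Definition resolvent H M lambda : V -> V :=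
  fun w => get (set_inverse (add_scale_set H lambda M) w).

Lemma resolvent_unique dot H M lambda gamma eta w :
  0 < gamma -> 0 < eta -> 0 < lambda ->
  strongly_monotone dot gamma H -> strongly_H_monotone dot H eta M ->
  set_inverse (add_scale_set H lambda M) w = [set resolvent H M lambda w].
Proof.
move=> g0 e0 l0 Hmon [Mmon Msurj].
have inj u v : set_inverse (add_scale_set H lambda M) w u ->
    set_inverse (add_scale_set H lambda M) w v -> u = v.
  move=> [x Mx xE] [y My yE].
  have := Hmon u v; have := Mmon _ _ _ _ Mx My => leM leH.
  have E : H u - H v = - (lambda *: (x - y)).
    have -> : H u = w - lambda *: x by rewrite -xE addrK.
    have -> : H v = w - lambda *: y by rewrite -yE addrK.
    by rewrite opprB addrC addrA subrK scalerBr opprB.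
  move: leH; rewrite E linearNl linearZl_LR /= lerNr => leH.
  have : lambda * (eta * `|u - v| ^+ 2) <= - (gamma * `|u - v| ^+ 2).
    by apply: le_trans leH; rewrite ler_pM2l.
  rewrite -subr_ge0 -opprD oppr_ge0 (mulrA lambda) -mulrDl pmulr_rle0; last first.
    by rewrite addr_gt0// mulr_gt0.
  by rewrite exprn_even_le0//= normr_eq0 subr_eq0 => /eqP.
have [v _ wv] : (\bigcup_(u in [set: V]) add_scale_set H lambda M u) w.
  by rewrite Msurj.
have wr : set_inverse (add_scale_set H lambda M) w (resolvent H M lambda w).
  exact: (getI (x := v)).
by apply/seteqP; split=> [u wu|u ->//]; apply: inj.
Qed.

End StrongMonotonicity.

(* Main.v *)
Require Import Defs.
From mathcomp Require Import all_boot all_order all_algebra.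
From mathcomp Require Import sesquilinear.
From mathcomp Require Import all_classical all_reals all_analysis.
From mathcomp Require Import ring lra.

Import Order.TTheory GRing.Theory Num.Theory.
Import numFieldNormedType.Exports.

Local Open Scope classical_set_scope.
Local Open Scope ring_scope.

(** Solutions of [0 \in A u + M u] are fixed points of
    [G u := (H + lambda M)^-1 (H u - lambda A u)], and [G] is a contraction
    with factor [kappa]. Two estimates give this. Strong monotonicity of [H]
    and [M] makes [H + lambda M] strongly monotone with constant
    [gamma + lambda * eta], so that its inverse is Lipschitz with the inverse
    constant ([resolvent_lipschitz]). Expanding the square of a norm bounds the
    Lipschitz constant of [H - lambda A] by the square root in [kappa]
    ([forward_step_lipschitz]). The conditions on [lambda] say that [lambda]
    lies strictly between the two roots of a quadratic polynomial whose
    negativity is [kappa < 1] ([contraction_factor_lt1]).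

    All four schemes are then instances of one, the Ishikawa iteration
      [x' = (1 - a) x + a G ((1 - b) x + b G x)],
    with [a = 1, b = 0] for [u_], [a = xi, b = mu] for [q_], [a = xi, b = 0]
    for [nu_] and [a = 1, b = mu] for [s_]. Each step multiplies the distance
    to the fixed point by at most [1 - a (1 - kappa)], and the product of these
    factors tends to [0] because the steps [a] have a divergent sum
    ([ishikawa_cvg]). Thus each of the four limits holds by itself, and the
    equivalence follows. *)

(** * The inner product *)

Section InnerProduct.
Context {R : realType} {V : normedModType R} {dot : {dot V for @idfun R}}.
Hypothesis norm_dot : forall x : V, `|x| = Num.sqrt (dot x x).
Implicit Types x y : V.

Lemma sqr_norm_dot x : `|x| ^+ 2 = dot x x.
Proof.
rewrite norm_dot sqr_sqrtr//.
have [->|x0] := eqVneq x 0; first by rewrite linear0l.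
exact/ltW/neq0_dnorm_gt0.
Qed.

Lemma dotC x y : dot x y = dot y x.
Proof. by rewrite hermC /= expr0 mul1r. Qed.

Lemma sqr_normB x y : `|x - y| ^+ 2 = `|x| ^+ 2 - 2 * dot x y + `|y| ^+ 2.
Proof.
rewrite !sqr_norm_dot linearBl /= !linearBr /= (dotC y x).
by ring.
Qed.

(** Cauchy-Schwarz: for nonzero [x] and [y], [`| `|y| *: x - `|x| *: y | ^+ 2]
    is nonnegative and has the factor [`|x| * `|y| - dot x y]. *)
Lemma dot_le_norm x y : dot x y <= `|x| * `|y|.
Proof.
have [->|x0] := eqVneq x 0; first by rewrite linear0l normr0 mul0r.
have [->|y0] := eqVneq y 0; first by rewrite linear0r normr0 mulr0.
have xy0 : 0 < `|x| * `|y| by rewrite mulr_gt0 ?normr_gt0.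
have := sqr_ge0 `| `|y| *: x - `|x| *: y |.
have -> : `| `|y| *: x - `|x| *: y | ^+ 2 =
    2 * (`|x| * `|y|) * (`|x| * `|y| - dot x y).
  have dotZ a b : dot (a *: x) (b *: y) = a * (b * dot x y).
    by rewrite linearZl_LR linearZr_LR.
  by rewrite sqr_normB !normrZ !normr_id dotZ; ring.
by rewrite pmulr_rge0 ?subr_ge0// mulr_gt0.
Qed.

End InnerProduct.

(** * The forward-backward operator is a contraction *)

Section Contraction.
Context {R : realType} {V : normedModType R} {dot : {dot V for @idfun R}}.
Hypothesis norm_dot : forall x : V, `|x| = Num.sqrt (dot x x).
Context {H A : V -> V} {M : V -> set V} {gamma tau s r eta lambda : R}.
Hypotheses (gamma_gt0 : 0 < gamma) (eta_gt0 : 0 < eta).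
Hypothesis lambda_gt0 : 0 < lambda.
Hypothesis H_monotone : strongly_monotone dot gamma H.
Hypothesis M_monotone : strongly_H_monotone dot H eta M.

Lemma resolventP u w :
  (exists2 x, M u x & H u + lambda *: x = w) <-> u = resolvent H M lambda w.
Proof.
have E := resolvent_unique w
  gamma_gt0 eta_gt0 lambda_gt0 H_monotone M_monotone.
split=> [Mu|->]; first by have : [set resolvent H M lambda w] u by rewrite -E.
have : set_inverse (add_scale_set H lambda M) w (resolvent H M lambda w).
  by rewrite E.
by [].
Qed.

Lemma resolvent_fixpoint xstar : add_set A M xstar 0 ->
  resolvent H M lambda (H xstar - lambda *: A xstar) = xstar.
Proof.
move=> [x Mx Ax]; apply/esym/resolventP; exists x => //.
by rewrite -(addr0_eq Ax) scalerN.
Qed.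

(** If [w] lies in [(H + lambda M) u] and [w'] in [(H + lambda M) u'], then
    pairing [w - w'] with [u - u'] and adding the two monotonicity
    inequalities gives
    [(gamma + lambda * eta) * `|u - u'| ^+ 2 <= dot (w - w') (u - u')];
    Cauchy-Schwarz finishes. *)
Lemma resolvent_lipschitz w w' :
  (gamma + lambda * eta) *
    `|resolvent H M lambda w - resolvent H M lambda w'| <= `|w - w'|.
Proof.
set u := resolvent _ _ _ w; set u' := resolvent _ _ _ w'.
have [x Mx wE] := (resolventP u w).2 erefl.
have [x' Mx' w'E] := (resolventP u' w').2 erefl.
have [->|uu'] := eqVneq u u'; first by rewrite subrr normr0 mulr0.
have d_gt0 : 0 < `|u - u'| by rewrite normr_gt0 subr_eq0.
rewrite -(ler_pM2r d_gt0); apply: le_trans (dot_le_norm norm_dot _ _).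
have -> : w - w' = (H u - H u') + lambda *: (x - x').
  by rewrite -wE -w'E scalerBr opprD addrACA.
have -> : dot (H u - H u' + lambda *: (x - x')) (u - u') =
    dot (H u - H u') (u - u') + lambda * dot (x - x') (u - u').
  by rewrite linearDl linearZl_LR.
have hH := H_monotone u u'.
have hM : lambda * (eta * `|u - u'| ^+ 2) <= lambda * dot (x - x') (u - u').
  by rewrite ler_pM2l//; apply: M_monotone.1.
by apply: le_trans (lerD hH hM); rewrite expr2; lra.
Qed.

Hypotheses (tau_gt0 : 0 < tau) (s_gt0 : 0 < s).
Hypothesis H_lipschitz : tau.-lipschitz H.
Hypothesis A_lipschitz : s.-lipschitz A.
Hypothesis A_monotone : strongly_monotone_wrt dot H r A.

(** Expand the square of the left-hand side: monotonicity of [A] with respect to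
    [H] bounds the cross term. A negative radicand is harmless, since the bound
    on the square then forces [x = y]. *)
Lemma forward_step_lipschitz x y :
  `|(H x - lambda *: A x) - (H y - lambda *: A y)| <=
  Num.sqrt (tau ^+ 2 - 2 * lambda * r + lambda ^+ 2 * s ^+ 2) * `|x - y|.
Proof.
have -> : (H x - lambda *: A x) - (H y - lambda *: A y) =
    (H x - H y) - lambda *: (A x - A y).
  by rewrite scalerBr opprD opprK addrACA opprB [- _ + _]addrC.
set c := _ + _ * s ^+ 2.
have sqr_le : `|(H x - H y) - lambda *: (A x - A y)| ^+ 2 <= c * `|x - y| ^+ 2.
  rewrite (sqr_normB norm_dot) normrZ (gtr0_norm lambda_gt0) exprMn.
  have -> : dot (H x - H y) (lambda *: (A x - A y)) =
      lambda * dot (A x - A y) (H x - H y).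
    by rewrite linearZr_LR dotC.
  have hH : `|H x - H y| ^+ 2 <= (tau * `|x - y|) ^+ 2.
    by apply: lerXn2r; [rewrite nnegrE| |exact: (H_lipschitz (x, y))];
      rewrite // nnegrE mulr_ge0// ltW.
  have hA : `|A x - A y| ^+ 2 <= (s * `|x - y|) ^+ 2.
    by apply: lerXn2r; [rewrite nnegrE| |exact: (A_lipschitz (x, y))];
      rewrite // nnegrE mulr_ge0// ltW.
  have hAH := A_monotone x y.
  have l2 : 0 <= lambda ^+ 2 by exact: sqr_ge0.
  have := ler_wpM2l l2 hA; have := ler_wpM2l (ltW lambda_gt0) hAH.
  by move: hH; rewrite !exprMn /c; lra.
rewrite -[leLHS]normr_id -sqrtr_sqr; apply: le_trans (ler_wsqrtr sqr_le) _.
by rewrite [c * _]mulrC sqrtrM ?sqr_ge0// sqrtr_sqr normr_id mulrC.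
Qed.

Lemma forward_backward_lipschitz x y :
  `|resolvent H M lambda (H x - lambda *: A x) -
    resolvent H M lambda (H y - lambda *: A y)| <=
  1 / (gamma + lambda * eta) *
    Num.sqrt (tau ^+ 2 - 2 * lambda * r + lambda ^+ 2 * s ^+ 2) * `|x - y|.
Proof.
have c_gt0 : 0 < gamma + lambda * eta by rewrite addr_gt0// mulr_gt0.
rewrite div1r -mulrA -(ler_pM2l c_gt0) mulVKf ?gt_eqF//.
exact: le_trans (resolvent_lipschitz _ _) (forward_step_lipschitz x y).
Qed.

End Contraction.

(** With [D = s ^+ 2 - eta ^+ 2] and [p = r + gamma * eta], squaring the
    hypothesis gives
    [(D * lambda - p) ^+ 2 < p ^+ 2 - D * (tau ^+ 2 - gamma ^+ 2)], and dividing
    by [D] turns it into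
    [tau ^+ 2 - 2 * lambda * r + lambda ^+ 2 * s ^+ 2
       < (gamma + lambda * eta) ^+ 2]. *)
Lemma contraction_factor_lt1 (R : realType) (gamma tau s r eta lambda : R) :
  0 < gamma -> 0 < eta -> 0 < lambda -> eta < s ->
  `|lambda - (r + gamma * eta) / (s ^+ 2 - eta ^+ 2)| <
    Num.sqrt ((r + gamma * eta) ^+ 2 -
              (s ^+ 2 - eta ^+ 2) * (tau ^+ 2 - gamma ^+ 2)) /
    (s ^+ 2 - eta ^+ 2) ->
  1 / (gamma + lambda * eta) *
    Num.sqrt (tau ^+ 2 - 2 * lambda * r + lambda ^+ 2 * s ^+ 2) < 1.
Proof.
move=> gamma_gt0 eta_gt0 lambda_gt0 eta_lt_s.
have : 0 < s ^+ 2 - eta ^+ 2.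
  by rewrite subr_gt0 ltr_pXn2r// nnegrE ltW// (lt_trans eta_gt0).
set D := s ^+ 2 - _; set p := r + _ => D_gt0.
rewrite ltr_pdivlMr// -{2}(gtr0_norm D_gt0) -normrM.
rewrite mulrBl divfK ?gt_eqF// => lt_sqrt.
have sqrt_gt0 := le_lt_trans (normr_ge0 _) lt_sqrt.
have : `|lambda * D - p| ^+ 2 < p ^+ 2 - D * (tau ^+ 2 - gamma ^+ 2).
  rewrite -[ltRHS]sqr_sqrtr; last by rewrite ltW// -sqrtr_gt0.
  by rewrite ltr_pXn2r ?nnegrE// ltW.
rewrite real_normK ?num_real// => quad.
have {}quad : D * (D * lambda ^+ 2 - 2 * lambda * p) <
    D * (gamma ^+ 2 - tau ^+ 2) by lra.
move: quad; rewrite ltr_pM2l// => quad.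
have c_gt0 : 0 < gamma + lambda * eta by rewrite addr_gt0// mulr_gt0.
rewrite div1r mulrC ltr_pdivrMr// mul1r -(gtr0_norm c_gt0) -sqrtr_sqr.
rewrite ltr_sqrt ?exprn_gt0//; move: quad; rewrite /D /p; lra.
Qed.

(** * Convergence of the Ishikawa iteration *)

(** By induction [d n * (1 + series t n) <= d 0], as
    [(1 - t) * (1 + S + t) <= 1 + S]; this replaces the usual passage through
    the exponential to bound the product of the factors [1 - t k]. *)
Lemma contractive_recursion_cvg0 (R : realType) (d t : nat -> R) :
  (forall n, 0 <= d n) -> (forall n, 0 <= t n) ->
  (forall n, d n.+1 <= (1 - t n) * d n) ->
  series t @ \oo --> +oo -> d @ \oo --> (0 : R).
Proof.
move=> d_ge0 t_ge0 dS t_sum.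
have S_ge0 n : 0 <= series t n by rewrite sumr_ge0.
have dM n : d n * (1 + series t n) <= d 0.
  elim: n => [|n IHn]; first by rewrite /series /= big_geq// addr0 mulr1.
  apply: le_trans IHn; rewrite seriesSr.
  have c_ge0 : 0 <= 1 + (series t n + t n) by rewrite !addr_ge0.
  apply: le_trans (ler_wpM2r c_ge0 (dS n)) _.
  have := mulr_ge0 (d_ge0 n) (mulr_ge0 (t_ge0 n) (S_ge0 n)).
  have := mulr_ge0 (d_ge0 n) (sqr_ge0 (t n)); lra.
apply/cvgr0Pnorm_le => e e_gt0; move/cvgryPge: t_sum => /(_ (d 0 / e)).
apply: filterS => n; rewrite ler_pdivrMr// => le_S.
have c_gt0 : 0 < 1 + series t n by rewrite ltr_wpDr.
rewrite ger0_norm// -(ler_pM2r c_gt0) (le_trans (dM n))//.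
by rewrite (le_trans le_S)// mulrC ler_pM2l// lerDr.
Qed.

Section Ishikawa.
Context {R : realType} {V : normedModType R}.
Implicit Types (G : V -> V) (k a b : R).

(** Both averages of an Ishikawa step have this form. For [k < 1] the factor is
    at most [1]; this is all that is used of the inner average, and the outer
    one brings the gain [a * (1 - k)]. *)
Lemma dist_average_le (x y p : V) a k : 0 <= a <= 1 ->
  `|y - p| <= k * `|x - p| ->
  `|(1 - a) *: x + a *: y - p| <= (1 - a * (1 - k)) * `|x - p|.
Proof.
move=> /andP[a_ge0 a_le1] yp.
have -> : (1 - a) *: x + a *: y - p = (1 - a) *: (x - p) + a *: (y - p).
  rewrite !scalerBr addrACA -opprD -scalerDl subrK scale1r//.
apply: le_trans (ler_normD _ _) _.
rewrite !normrZ (ger0_norm a_ge0) ger0_norm ?subr_ge0//.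
by have := ler_wpM2l a_ge0 yp; lra.
Qed.

Lemma ishikawa_cvg G k (p : V) (a b : nat -> R) (x y : nat -> V) :
  0 <= k < 1 -> (forall z, `|G z - p| <= k * `|z - p|) ->
  (forall n, 0 <= a n <= 1) -> (forall n, 0 <= b n <= 1) ->
  series a @ \oo --> +oo ->
  (forall n, y n = (1 - b n) *: x n + b n *: G (x n)) ->
  (forall n, x n.+1 = (1 - a n) *: x n + a n *: G (y n)) ->
  x @ \oo --> p.
Proof.
move=> /andP[k_ge0 k_lt1] Gp a01 b01 a_sum yE xS.
have k'_gt0 : 0 < 1 - k by rewrite subr_gt0.
have y_le n : `|y n - p| <= `|x n - p|.
  rewrite yE (le_trans (dist_average_le _ _ _ _ _ (b01 n) (Gp (x n))))//.
  have /andP[b_ge0 _] := b01 n.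
  by rewrite ler_piMl// gerBl mulr_ge0// ltW.
have dS n : `|x n.+1 - p| <= (1 - a n * (1 - k)) * `|x n - p|.
  rewrite xS; apply: dist_average_le => //.
  by rewrite (le_trans (Gp _))// ler_wpM2l.
apply/subr_cvg0; apply: norm_cvg0.
apply: (contractive_recursion_cvg0 _ _ (fun n => a n * (1 - k))) => // [n|].
  by have /andP[a_ge0 _] := a01 n; rewrite mulr_ge0// ltW.
apply/cvgryPge => B; move/cvgryPge: a_sum => /(_ (B / (1 - k))).
by apply: filterS => n; rewrite ler_pdivrMr// /series /= mulr_suml.
Qed.

End Ishikawa.

Lemma series1_cvgy (R : realType) : series (fun=> 1 : R) @ \oo --> +oo.
Proof.
have -> : series (fun=> 1 : R) = fun n => n%:R.
  by apply/funext => n; rewrite /series /= big_const_nat iter_addr_0 subn0.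
exact: cvgr_idn.
Qed.

(** * The four iterations *)

Theorem corollary2 (R : realType) (V : completeNormedModType R)
  (dot : {dot V for @idfun R})
  (norm_dot : forall x : V, `|x| = Num.sqrt (dot x x))
  (H A : V -> V) (M : V -> set V)
  (gamma tau s r eta lambda kappa : R)
  (gamma_gt0 : 0 < gamma) (tau_gt0 : 0 < tau) (s_gt0 : 0 < s) (r_gt0 : 0 < r)
  (eta_gt0 : 0 < eta) (lambda_gt0 : 0 < lambda)
  (H_monotone : strongly_monotone dot gamma H)
  (H_lipschitz : tau.-lipschitz H)
  (A_lipschitz : s.-lipschitz A)
  (A_monotone : strongly_monotone_wrt dot H r A)
  (M_nonempty : forall u, M u !=set0)
  (M_monotone : strongly_H_monotone dot H eta M)
  (lambda_bound :
     `|lambda - (r + gamma * eta) / (s ^+ 2 - eta ^+ 2)| <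
     Num.sqrt ((r + gamma * eta) ^+ 2 -
               (s ^+ 2 - eta ^+ 2) * (tau ^+ 2 - gamma ^+ 2)) /
     (s ^+ 2 - eta ^+ 2))
  (discr_gt0 : (r + gamma * eta) ^+ 2 >
               (s ^+ 2 - eta ^+ 2) * (tau ^+ 2 - gamma ^+ 2))
  (s_gt_eta : s > eta)
  (kappa_def : kappa = 1 / (gamma + lambda * eta) *
     Num.sqrt (tau ^+ 2 - 2 * lambda * r + lambda ^+ 2 * s ^+ 2))
  (xstar : V) (xstar_sol : add_set A M xstar 0)
  (xi mu : nat -> R)
  (xi_01 : forall n, 0 <= xi n <= 1) (mu_01 : forall n, 0 <= mu n <= 1)
  (xi_cvg0 : xi @ \oo --> (0 : R))
  (xi_sum : series xi @ \oo --> +oo)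
  (xi_mu_sum : series (fun n => xi n * mu n * (1 - kappa)) @ \oo --> +oo)
  (u_ q_ r_ nu_ s_ t_ : nat -> V)
  (uS : forall n, u_ n.+1 =
     resolvent H M lambda (H (u_ n) - lambda *: A (u_ n)))
  (rE : forall n, r_ n = (1 - mu n) *: q_ n +
     mu n *: resolvent H M lambda (H (q_ n) - lambda *: A (q_ n)))
  (qS : forall n, q_ n.+1 = (1 - xi n) *: q_ n +
     xi n *: resolvent H M lambda (H (r_ n) - lambda *: A (r_ n)))
  (nuS : forall n, nu_ n.+1 = (1 - xi n) *: nu_ n +
     xi n *: resolvent H M lambda (H (nu_ n) - lambda *: A (nu_ n)))
  (tE : forall n, t_ n = (1 - mu n) *: s_ n +
     mu n *: resolvent H M lambda (H (s_ n) - lambda *: A (s_ n)))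
  (sS : forall n, s_ n.+1 =
     resolvent H M lambda (H (t_ n) - lambda *: A (t_ n))) :
  [<-> u_ @ \oo --> xstar;
       q_ @ \oo --> xstar;
       nu_ @ \oo --> xstar;
       s_ @ \oo --> xstar].
Proof.
pose G z := resolvent H M lambda (H z - lambda *: A z).
have k_lt1 : 0 <= kappa < 1.
  rewrite kappa_def contraction_factor_lt1// andbT.
  by rewrite mulr_ge0// ?sqrtr_ge0// div1r invr_ge0 addr_ge0 ?mulr_ge0// ltW.
have Gp z : `|G z - xstar| <= kappa * `|z - xstar|.
  rewrite kappa_def -{1}(resolvent_fixpoint gamma_gt0 eta_gt0 lambda_gt0
    H_monotone M_monotone _ xstar_sol).
  exact: (forward_backward_lipschitz norm_dot).
have one01 (n : nat) : 0 <= (1 : R) <= 1 by rewrite ler01 lexx.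
have zero01 (n : nat) : 0 <= (0 : R) <= 1 by rewrite lexx ler01.
have inner0 (x : nat -> V) n : x n = (1 - 0) *: x n + 0 *: G (x n).
  by rewrite subr0 scale1r scale0r addr0.
have outer1 x y : y = (1 - 1) *: x + 1 *: y :> V.
  by rewrite subrr scale0r scale1r add0r.
have u_cvg : u_ @ \oo --> xstar.
  apply: (ishikawa_cvg G kappa _ (fun=> 1) (fun=> 0) _ u_) => //.
    exact: series1_cvgy.
  by move=> n; rewrite uS; exact: outer1.
have q_cvg : q_ @ \oo --> xstar by exact: (ishikawa_cvg G kappa _ xi mu _ r_).
have nu_cvg : nu_ @ \oo --> xstar.
  exact: (ishikawa_cvg G kappa _ xi (fun=> 0) _ nu_).
have s_cvg : s_ @ \oo --> xstar.
  apply: (ishikawa_cvg G kappa _ (fun=> 1) mu _ t_) => //.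
    exact: series1_cvgy.
  by move=> n; rewrite sS; exact: outer1.
by tfae.
Qed.
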